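(* For every integer $n\geq 1$, the solvable Baumslag-Solitar group $\operatorname{BS}(1,n)=\langle a,t : tat^{-1}=a^n\rangle$ has infinite strong cop number, i.e. $\operatorname{sCop}(\operatorname{BS}(1,n))=\infty$.
   Context: Convention: $\mathbb{N}=\mathbb{Z}_{\geq 1}$. Graphs are connected, undirected, without double edges or loops, with the path metric on vertices. Game. Let $\Gamma$ be a graph. The cops and robbers game on $\Gamma$ has parameters: number of cops $n\in\mathbb{N}$, base point (treasure) $v\in\Gamma$ a vertex, cop speed $\sigma\in\mathbb{N}$, robber speed $\psi\in\mathbb{N}$, cop reach $\rho\in\mathbb{N}$, robber radius $R\in\mathbb{N}$. It is a two-player game with perfect information. First the cop player chooses $n$ vertices as starting positions of the cops, then the robber chooses a vertex as starting position. The players then alternate turns, starting with the cops. In each turn the cop player may move each cop along a path of length at most $\sigma$ to some vertex; then the robber moves along a path of length at most $\psi$ ending in a vertex. One cop move followed by one robber move is a stage. The cop player wins if the robber is captured, i.e. at some time during some stage the robber's position is at distance at most $\rho$ from some cop's position (this includes every vertex traversed by the robber during a move: the robber must traverse the path edge by edge without ever coming within distance $\rho$ of a cop), or if the cops eventually defend $v$, i.e. after some finite initial time the robber never enters the closed ball of radius $R$ around $v$. Otherwise the robber wins. The strong cop number $\operatorname{sCop}(\Gamma)\in\mathbb{N}\cup\{\infty\}$ is the infimum (with $\inf\emptyset=\infty$) of all $n\in\mathbb{N}$ such that $\forall v\in\Gamma,\ \exists\sigma\in\mathbb{N},\ \forall\psi\in\mathbb{N},\ \exists\rho\in\mathbb{N},\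 \forall R\in\mathbb{N}$: the cop player has a winning strategy with $n$ cops. This number is invariant under quasi-isometry, so for a finitely generated group $G$ one sets $\operatorname{sCop}(G):=\operatorname{sCop}(\operatorname{Cay}(G,S))$ for any finite generating set $S$. *)

(* Defs.v *)
From HB Require Import structures.
From mathcomp Require Import all_boot.
From mathcomp Require Import boolp constructive_ereal.

Set Implicit Arguments.
Unset Strict Implicit.
Unset Printing Implicit Defensive.

Definition linked (T : eqType) (e : rel T) (x y : T) : Prop :=
  exists p : seq T, path e x p /\ last x p = y.

Lemma linked_refl (T : eqType) (e : rel T) x : linked e x x.
Proof. by exists [::]. Qed.

Lemma linked_trans (T : eqType) (e : rel T) y x z :
  linked e x y -> linked e y z -> linked e x z.
Proof.
move=> [p [ep <-]] [q [eq <-]]; exists (p ++ q).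
by rewrite cat_path ep eq last_cat.
Qed.

Lemma linked_sym (T : eqType) (e : rel T) x y :
  symmetric e -> linked e x y -> linked e y x.
Proof.
move=> se [p [ep <-]]; exists (rev (belast x p)); split.
  by rewrite rev_path; rewrite (eq_path (e' := e)).
by case: p ep => //= z p _; rewrite rev_cons last_rcons.
Qed.

(* Connected simple graphs, possibly infinite. *)
Record graph := Graph {
  vertex :> eqType;
  adj : rel vertex;
  adj_sym : symmetric adj;
  adj_irrefl : irreflexive adj;
  adj_connected : forall x y : vertex, linked adj x y
}.
Arguments adj {g}.

Section PathMetric.
Variable G : graph.

Definition joined_in (x y : G) (d : nat) : bool :=
  `[< exists p : seq G, [/\ path adj x p, last x p = y & size p = d] >].

Fact joined_inP (x y : G) : exists d, joined_in x y d.
Proof.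
by have [p [ep lp]] := adj_connected x y; exists (size p); apply/asboolP; exists p.
Qed.

Definition gdist (x y : G) : nat := ex_minn (joined_inP x y).

End PathMetric.

Section Game.
Variables (G : graph) (k : nat).

(* A robber play is a starting vertex [r0] and a sequence of moves [m]; the
   move [m i] lists the vertices traversed in stage [i] after the vertex where
   the robber stands.  A move may be empty. *)
Fixpoint robber_pos (r0 : G) (m : nat -> seq G) (i : nat) : G :=
  if i is j.+1 then last (robber_pos r0 m j) (m j) else r0.

Definition robber_legal (psi : nat) (r0 : G) (m : nat -> seq G) : Prop :=
  forall i, path adj (robber_pos r0 m i) (m i) /\ size (m i) <= psi.

(* The cops' positions after their move in stage [size h] depend on the
   robber's start and on the list [h] of all the robber's earlier moves; their
   own earlier positions are determined by the same data. *)
Record cop_strategy := CopStrategy {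
  cop_start : 'I_k -> G;
  cop_move : G -> seq (seq G) -> 'I_k -> G
}.

(* Positions of the cops at the beginning of stage [i]; within stage [i] they
   are at [cop_pos s r0 m i.+1] once they have moved. *)
Definition cop_pos (s : cop_strategy) (r0 : G) (m : nat -> seq G) (i : nat) :
    'I_k -> G :=
  if i is j.+1 then cop_move s r0 (mkseq m j) else cop_start s.

Definition cop_legal (sigma : nat) (s : cop_strategy) (r0 : G)
    (m : nat -> seq G) : Prop :=
  forall i j, gdist (cop_pos s r0 m i j) (cop_pos s r0 m i.+1 j) <= sigma.

(* For [i > 0], the cops' positions at the start of stage [i] and the robber's
   are those at the end of stage [i.-1], so only stage 0 needs a separate
   clause for the moment before the cops move. *)
Definition captured (rho : nat) (s : cop_strategy) (r0 : G)
    (m : nat -> seq G) : Prop :=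
  (exists j, gdist (cop_start s j) r0 <= rho) \/
  (exists i j x, x \in robber_pos r0 m i :: m i /\
                 gdist (cop_pos s r0 m i.+1 j) x <= rho).

Definition defended (v : G) (R : nat) (r0 : G) (m : nat -> seq G) : Prop :=
  exists N, forall i, N <= i ->
    forall x, x \in robber_pos r0 m i :: m i -> R < gdist v x.

Definition winning_strategy (v : G) (sigma psi rho R : nat)
    (s : cop_strategy) : Prop :=
  forall r0 m, robber_legal psi r0 m ->
    cop_legal sigma s r0 m /\ (captured rho s r0 m \/ defended v R r0 m).

Definition cops_win (v : G) (sigma psi rho R : nat) : Prop :=
  exists s : cop_strategy, winning_strategy v sigma psi rho R s.

Definition strongly_cop_win : Prop :=
  forall v : G,
  exists sigma, 0 < sigma /\ forall psi, 0 < psi ->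
  exists rho, 0 < rho /\ forall R, 0 < R ->
  cops_win v sigma psi rho R.

End Game.

Definition sCop_candidate (G : graph) (k : nat) : bool :=
  (0 < k) && `[< strongly_cop_win G k >].

Definition sCop (G : graph) : \bar nat :=
  if pselect (exists k, sCop_candidate G k) is left ex_k
  then (ex_minn ex_k)%:E%E else (+oo)%E.

Section Cayley.
Local Open Scope group_scope.
Variable G : groupType.

Definition generates (S : seq G) : Prop :=
  forall H : {pred G}, group_closed H -> {subset S <= H} -> forall x, x \in H.

Definition cay_adj (S : seq G) : rel G :=
  fun x y => (x != y) && ((x^-1 * y \in S) || (y^-1 * x \in S)).

Variables (S : seq G) (genS : generates S).

Fact cay_adj_sym : symmetric (cay_adj S).
Proof. by move=> x y; rewrite /cay_adj eq_sym orbC. Qed.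

Fact cay_adj_irrefl : irreflexive (cay_adj S).
Proof. by move=> x; rewrite /cay_adj eqxx. Qed.

Fact cay_adj_connected x y : linked (cay_adj S) x y.
Proof.
pose H : {pred G} := [pred g | `[< forall z, linked (cay_adj S) z (z * g) >]].
suff /asboolP/(_ x) : x^-1 * y \in H by rewrite mulgA mulgV mul1g.
apply: genS => [|g gS].
  split=> [|g h /asboolP Hg /asboolP Hh].
    by apply/asboolP => z; rewrite mulg1; apply: linked_refl.
  apply/asboolP => z; apply: linked_trans (Hg z) _.
  by apply: linked_sym cay_adj_sym _; have := Hh (z * (g / h));
    rewrite -!mulgA mulVg mulg1.
apply/asboolP => z; have [->|g1] := eqVneq g 1.
  by rewrite mulg1; apply: linked_refl.
exists [:: z * g]; split=> //=; rewrite andbT /cay_adj mulgA mulVg mul1g gS.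
by rewrite andbT; apply: contra g1 => /eqP zg; rewrite -(mulKg z g) -zg mulVg.
Qed.

Definition Cay : graph :=
  Graph cay_adj_sym cay_adj_irrefl cay_adj_connected.

End Cayley.

(* The group presented by generators [X] and relations [rels]: words modulo the
   congruence generated by free cancellation and the relations.  The letter
   [(x, false)] stands for [x] and [(x, true)] for its inverse. *)
Section Presentation.
Local Open Scope quotient_scope.
Variable X : choiceType.

Definition word := seq (X * bool).

Variable rels : seq (word * word).

Inductive pres_eq : word -> word -> Prop :=
| pres_refl w : pres_eq w w
| pres_sym w1 w2 : pres_eq w1 w2 -> pres_eq w2 w1
| pres_trans w2 w1 w3 : pres_eq w1 w2 -> pres_eq w2 w3 -> pres_eq w1 w3
| pres_cancel u w x b : pres_eq (u ++ [:: (x, b); (x, ~~ b)] ++ w) (u ++ w)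
| pres_rel u w l r : (l, r) \in rels -> pres_eq (u ++ l ++ w) (u ++ r ++ w).

Definition pres_rel_bool : rel word := fun w1 w2 => `[< pres_eq w1 w2 >].

Fact pres_eq_refl : reflexive pres_rel_bool.
Proof. by move=> w; apply/asboolP; constructor. Qed.

Fact pres_eq_sym : symmetric pres_rel_bool.
Proof. by move=> v w; apply/asboolP/asboolP; apply: pres_sym. Qed.

Fact pres_eq_trans : transitive pres_rel_bool.
Proof.
by move=> v u w /asboolP uv /asboolP vw; apply/asboolP; apply: pres_trans uv vw.
Qed.

Canonical pres_equiv := EquivRel pres_rel_bool pres_eq_refl pres_eq_sym pres_eq_trans.

Definition presented := {eq_quot pres_equiv}.
HB.instance Definition _ := Choice.on presented.

Definition pres_class (w : word) : presented := (\pi_{eq_quot pres_equiv} w)%qT.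

Lemma pres_classP w1 w2 : pres_class w1 = pres_class w2 <-> pres_eq w1 w2.
Proof.
by split=> [/eqmodP/asboolP | h]; last by apply/eqmodP/asboolP.
Qed.

Lemma pres_class_repr (x : presented) : pres_class (repr x) = x.
Proof. exact: reprK. Qed.

Lemma pres_eq_ctx u w w1 w2 : pres_eq w1 w2 -> pres_eq (u ++ w1 ++ w) (u ++ w2 ++ w).
Proof.
elim=> {w1 w2} [v|v1 v2 _|v2 v1 v3 _ h1 _ h2|v1 v2 x b|v1 v2 l r lr].
- exact: pres_refl.
- exact: pres_sym.
- exact: pres_trans h1 h2.
- by have := pres_cancel (u ++ v1) (v2 ++ w) x b; rewrite -!catA.
- by have := pres_rel (u ++ v1) (v2 ++ w) lr; rewrite -!catA.
Qed.

Lemma pres_eq_cat u1 u2 w1 w2 :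
  pres_eq u1 u2 -> pres_eq w1 w2 -> pres_eq (u1 ++ w1) (u2 ++ w2).
Proof.
move=> hu hw; apply: (@pres_trans (u2 ++ w1)).
  exact: (pres_eq_ctx [::] w1 hu).
by have := pres_eq_ctx u2 [::] hw; rewrite !cats0.
Qed.

Definition word_inv (w : word) : word := rev [seq (p.1, ~~ p.2) | p <- w].

Lemma word_invK : involutive word_inv.
Proof.
move=> w; rewrite /word_inv map_rev revK -map_comp -[RHS]map_id.
by apply: eq_map => -[x b] /=; rewrite negbK.
Qed.

Lemma word_mulV w : pres_eq (w ++ word_inv w) [::].
Proof.
elim: w => [|[x b] w IH] /=; first exact: pres_refl.
rewrite /word_inv /= rev_cons -cats1.
apply: (@pres_trans [:: (x, b); (x, ~~ b)]); last first.
  exact: (pres_cancel [::] [::] x b).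
by have := pres_eq_ctx [:: (x, b)] [:: (x, ~~ b)] IH; rewrite /= -catA.
Qed.

Lemma word_Vmul w : pres_eq (word_inv w ++ w) [::].
Proof. by have := word_mulV (word_inv w); rewrite word_invK. Qed.

Definition pres_one : presented := pres_class [::].
Definition pres_mul (x y : presented) : presented :=
  pres_class (repr x ++ repr y).
Definition pres_inv (x : presented) : presented := pres_class (word_inv (repr x)).

Lemma pres_mulE w1 w2 :
  pres_mul (pres_class w1) (pres_class w2) = pres_class (w1 ++ w2).
Proof.
by apply/pres_classP; apply: pres_eq_cat; apply/pres_classP;
  rewrite pres_class_repr.
Qed.

Fact pres_mulA : associative pres_mul.
Proof.
move=> x y z; rewrite -(pres_class_repr x) -(pres_class_repr y).
by rewrite -(pres_class_repr z) !pres_mulE catA.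
Qed.

Fact pres_mul1 : left_id pres_one pres_mul.
Proof. by move=> x; rewrite -(pres_class_repr x) pres_mulE. Qed.

Fact pres_mulr1 : right_id pres_one pres_mul.
Proof. by move=> x; rewrite -(pres_class_repr x) pres_mulE cats0. Qed.

Fact pres_mulV : left_inverse pres_one pres_inv pres_mul.
Proof.
move=> x; rewrite -{2}(pres_class_repr x) pres_mulE.
by apply/pres_classP/word_Vmul.
Qed.

Fact pres_mulrV : right_inverse pres_one pres_inv pres_mul.
Proof.
move=> x; rewrite -{1}(pres_class_repr x) pres_mulE.
by apply/pres_classP/word_mulV.
Qed.

HB.instance Definition _ := isGroup.Build presented
  pres_mulA pres_mul1 pres_mulr1 pres_mulV pres_mulrV.

Definition pres_gen (x : X) : presented := pres_class [:: (x, false)].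

Lemma pres_class_cat w1 w2 :
  pres_class (w1 ++ w2) = (pres_class w1 * pres_class w2)%g.
Proof. by rewrite -pres_mulE. Qed.

Lemma pres_genV x : pres_class [:: (x, true)] = (pres_gen x)^-1%g.
Proof.
apply: (@mulgI _ (pres_gen x)); rewrite mulgV -pres_class_cat.
exact/pres_classP/(pres_cancel [::] [::]).
Qed.

Lemma pres_class_rel l r : (l, r) \in rels -> pres_class l = pres_class r.
Proof.
move=> lr; apply/pres_classP.
by have := pres_rel [::] [::] lr; rewrite !cat0s !cats0.
Qed.

Lemma pres_class_nseq m x : pres_class (nseq m (x, false)) = (pres_gen x ^+ m)%g.
Proof. by elim: m => // m IH; rewrite expgS -IH -pres_class_cat. Qed.

Lemma pres_gen_generates (S : seq presented) :
  (forall x, pres_gen x \in S) -> generates S.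
Proof.
move=> genS H [H1 HF] SH g; rewrite -(pres_class_repr g).
elim: (repr g) => [|[x b] w IH]; first exact: H1.
have HV h : h \in H -> (h^-1)%g \in H.
  by move=> hH; rewrite -(mul1g h^-1)%g; apply: HF.
rewrite -cat1s pres_class_cat -[pres_class w]invgK; apply: HF; last exact: HV.
by case: b; rewrite ?pres_genV; [apply: HV|]; apply/SH/genS.
Qed.

End Presentation.

Variant bs_gen := gen_a | gen_t.

Definition bs_gen_bool (x : bs_gen) : bool := if x is gen_t then true else false.
Definition bool_bs_gen (b : bool) : bs_gen := if b then gen_t else gen_a.
Fact bs_gen_boolK : cancel bs_gen_bool bool_bs_gen. Proof. by case. Qed.
HB.instance Definition _ := Choice.copy bs_gen (can_type bs_gen_boolK).

Definition BS1 (n : nat) : groupType :=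
  presented [:: ([:: (gen_t, false); (gen_a, false); (gen_t, true)],
                 nseq n (gen_a, false))].

Definition bs_a (n : nat) : BS1 n := pres_gen _ gen_a.
Definition bs_t (n : nat) : BS1 n := pres_gen _ gen_t.

Lemma BS1_relation n :
  (bs_t n * bs_a n * (bs_t n)^-1 = bs_a n ^+ n)%g.
Proof.
rewrite -pres_genV -[(bs_t n * bs_a n)%g]pres_class_cat -[LHS]pres_class_cat.
by rewrite -pres_class_nseq; apply: pres_class_rel; apply: mem_head.
Qed.

Lemma BS1_generates n : generates [:: bs_a n; bs_t n].
Proof.
by apply: pres_gen_generates; case; rewrite !inE eqxx ?orbT.
Qed.

(* Main.v *)
Require Import Defs.
From mathcomp Require Import all_boot all_order all_algebra.
From mathcomp Require Import boolp constructive_ereal.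
From mathcomp Require Import zify ring lra.

Set Implicit Arguments.
Unset Strict Implicit.
Unset Printing Implicit Defensive.

(** A robber beats [k] cops on any graph that contains, at every scale [N], a
    grid of [k + 1] rows and [k + 1] columns: every row meets every column, two
    crossings of one line are joined inside that line by a route of length at
    most [C * N], and two rows (or two columns) are at distance more than [N].
    Here [C] does not depend on [N].

    To see this ([grid_robber_wins]), cut time into phases so short that a cop
    covers only a small fraction of [N] during two of them.  By the pigeonhole
    principle, at each moment some row is far from all [k] cops, as a cop cannot
    be close to two rows; that row stays out of reach during the next two
    phases.  The same holds for columns.  So the robber, standing on a safe row,
    selects a safe column, spends a phase walking along the row to that column,
    meanwhile the cops commit themselves, selects a safe row, and so on.  He is
    never caught, and never leaves the bounded grid.  A phase lasts about
    [N / (8 sigma)] stages, so a robber speed proportional to [C * sigma] is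
    enough to finish a route in one phase; this speed does not depend on the
    reach [rho], which is why the ratio [C] has to be uniform in [N], and why
    [N] can afterwards be taken large compared with [rho]
    ([has_grids_sCop]).

    Having such grids is invariant under bi-Lipschitz maps
    ([has_grids_bilipschitz]), so in [BS(1,n)] it suffices to find them for the
    generators [a] and [t].  The group maps to pairs [(x, h)] with
    [(x, h) (y, g) = (x + n^h y, h + g)], where [a] goes to [(1, 0)] and [t] to
    [(0, 1)].  For [n = 1] the grid is the usual one in the plane
    ([has_grids_BS11]).  For [n >= 2] the large-scale geometry of the group is
    that of a horocyclic product of two trees: at height [h], one tree sees the
    size of [x] at scale [n^h], the other sees [x] modulo [n^h].  In the
    horocyclic product of two stars there is a complete bipartite graph: its
    edges are the vertical segments over [x = i n^(2H) + j] for [0 <= h <= 2H],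
    those with the same [i] come together at the bottom, those with the same
    [j] at the top.  Cut at height [H], the star of each bottom vertex is a row
    and the star of each top vertex is a column, crossing at the midpoints
    ([has_grids_BS1]).  Two rows are far apart since elements below height [H]
    with real parts [n^(2H)] apart are not joined by a path shorter than [H]
    ([gdist_low]).  Two columns are far apart since a short path above height
    [H] changes [x] by a multiple of a large power of [n] ([gdist_high]). *)

(** * Routes in a graph *)

Section Metric.
Variable G : graph.
Implicit Types x y z : G.

Lemma gdist_path x y :
  exists p : seq G, [/\ path adj x p, last x p = y & size p = gdist x y].
Proof. by rewrite /gdist; case: ex_minnP => d /asboolP. Qed.

Lemma gdist_le_size x (p : seq G) :
  path adj x p -> gdist x (last x p) <= size p.
Proof.
move=> xp; rewrite /gdist; case: ex_minnP => d _; apply.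
by apply/asboolP; exists p.
Qed.

Lemma gdist_triangle x y z : gdist x z <= gdist x y + gdist y z.
Proof.
have [p [xp py <-]] := gdist_path x y; have [q [yq qz <-]] := gdist_path y z.
by rewrite -size_cat -qz -py -last_cat gdist_le_size// cat_path xp py.
Qed.

End Metric.

Section Joined.
Variable G : graph.
Implicit Types (P Q : G -> Prop) (x y z : G).

Definition route P (L : nat) x y (q : seq G) : Prop :=
  [/\ path adj x q, last x q = y, size q <= L & forall z, z \in x :: q -> P z].

Definition joined P L x y : Prop := exists q, route P L x y q.

Lemma joined_trans P L1 L2 y x z :
  joined P L1 x y -> joined P L2 y z -> joined P (L1 + L2) x z.
Proof.
move=> [q [xq <- qL qP]] [r [yr <- rL rP]]; exists (q ++ r); split.
- by rewrite cat_path xq yr.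
- by rewrite last_cat.
- by rewrite size_cat leq_add.
- move=> w; rewrite -cat_cons mem_cat => /orP[/qP//|wr].
  by apply: rP; rewrite inE wr orbT.
Qed.

Lemma joined_sym P L x y : joined P L x y -> joined P L y x.
Proof.
move=> [q [xq qy qL qP]]; exists (rev (belast x q)); split.
- by rewrite -qy rev_path (eq_path (e' := adj)) // => a b; rewrite /= adj_sym.
- by case: q qy {xq qL qP} => [//|a q] _ /=; rewrite rev_cons last_rcons.
- by rewrite size_rev size_belast.
- by move=> z; rewrite -{1}qy -rev_rcons -lastI mem_rev => /qP.
Qed.

Lemma joined_leq P L L' x y : L <= L' -> joined P L x y -> joined P L' x y.
Proof.
by move=> LL' [q [? ? qL ?]]; exists q; split=> //; apply: leq_trans LL'.
Qed.

Lemma joined_refl P L x : P x -> joined P L x x.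
Proof. by move=> Px; exists [::]; split=> // z; rewrite inE => /eqP->. Qed.

Lemma joined_ball x y d : gdist x y <= d ->
  joined (fun z => gdist x z <= d) d x y.
Proof.
have [q [xq qy qd]] := gdist_path x y; rewrite -qd => qsize.
exists q; split=> // z; rewrite inE => /predU1P[->|zq].
  exact: leq_trans (gdist_le_size (p := [::]) isT) _.
apply: leq_trans qsize; case/splitPr: q / zq xq {qy qd} => q1 q2.
rewrite -cat_rcons cat_path => /andP[xq1 _].
have := gdist_le_size xq1; rewrite last_rcons => /leq_trans; apply.
by rewrite size_cat leq_addr.
Qed.

Lemma gdist_sym x y : gdist x y = gdist y x.
Proof.
suff le (u v : G) : gdist u v <= gdist v u by apply/anti_leq; rewrite !le.
have [p [vp pu <-]] := gdist_path v u.
have [q [uq <- qp _]] : joined (fun=> True) (size p) u v.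
  by apply: joined_sym; exists p; split.
exact: leq_trans (gdist_le_size uq) qp.
Qed.

End Joined.

(** * Grids and cops *)

Section Grid.
Variables (G : graph) (m : nat).
Implicit Types (p : 'I_m -> 'I_m -> G) (line : bool -> 'I_m -> G -> Prop).

(** The lines of kind [false] are the rows and those of kind [true] the columns;
    [p i j] is where row [i] meets column [j].  The crossing of line [i] of kind
    [b] with line [j] of the other kind treats both kinds alike, as the robber
    alternates between them. *)
Definition crossing p (b : bool) (i j : 'I_m) := if b then p j i else p i j.

Lemma crossingC p b i j : crossing p (~~ b) j i = crossing p b i j.
Proof. by case: b. Qed.

Record grid (L D : nat) p line : Prop := Grid {
  grid_route b i j j' :
    joined (line b i) L (crossing p b i j) (crossing p b i j');
  grid_separated b i i' x y :
    i != i' -> line b i x -> line b i' y -> D < gdist x y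
}.

(** A cop within [d] of two different lines would bring them within [2 * d] of
    each other.  So the cops spoil at most one line each, and there are more
    lines than cops. *)
Lemma far_line k L D d p line b (c : 'I_k -> G) :
  grid L D p line -> k < m -> 2 * d <= D ->
  exists i, forall j y, line b i y -> d < gdist (c j) y.
Proof.
move=> gr km dD; apply: contrapT => /forallNP near.
have /choice[h hP] : forall i, exists j, exists2 y,
    line b i y & gdist (c j) y <= d.
  move=> i; apply: contrapT => N; apply: (near i) => j y iy.
  by rewrite ltnNge; apply/negP => le; apply: N; exists j, y.
have /injectivePn[i [i' ii' hii']] : ~~ injectiveb h.
  apply/injectiveP => /leq_card; rewrite !card_ord; lia.
have [y iy ley] := hP i; have [y' iy' ley'] := hP i'.
have := grid_separated gr ii' iy iy'.
rewrite -hii' in ley'; have := gdist_triangle y (c (h i)) y'.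
by rewrite (gdist_sym y (c _)); lia.
Qed.

End Grid.

Section CopMoves.
Variables (G : graph) (k : nat) (s : cop_strategy G k).

(** The cops' positions at time [i] only use the moves before time [i], and at
    time 0 not even the robber's start.  This allows the robber to choose his
    lines one by one from what the cops have done so far. *)
Lemma cop_pos_ext r0 r0' (m m' : nat -> seq G) i :
  (0 < i -> r0 = r0') -> (forall i', i' < i -> m i' = m' i') ->
  cop_pos s r0 m i = cop_pos s r0' m' i.
Proof.
case: i => // i /(_ isT) -> mm' /=; congr (cop_move _ _ _).
apply: (@eq_from_nth _ [::]); rewrite ?size_mkseq// => j ji.
by rewrite !nth_mkseq// mm'// (leq_trans ji).
Qed.

Lemma cop_pos_dist sigma r0 (m : nat -> seq G) j i d :
  cop_legal sigma s r0 m ->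
  gdist (cop_pos s r0 m i j) (cop_pos s r0 m (i + d) j) <= d * sigma.
Proof.
move=> legal; elim: d => [|d IH].
  by rewrite addn0 (gdist_le_size (p := [::])).
apply: leq_trans (gdist_triangle _ (cop_pos s r0 m (i + d) j) _) _.
by rewrite mulSn addnC addnS leq_add.
Qed.

End CopMoves.

(** * The robber's strategy *)

(** Dependent choice with memory: the next value may depend on the whole list
    of the previous ones, as a line depends on the play so far. *)
Lemma history_choice (T : Type) (P : seq T -> T -> Prop) :
  (forall l, exists x, P l x) ->
  exists f : nat -> T, forall i, P (mkseq f i) (f i).
Proof.
move=> /choice[F PF]; pose hist i := iter i (fun l => rcons l (F l)) [::].
exists (F \o hist) => i.
suff -> : mkseq (F \o hist) i = hist i by exact: PF.
by elim: i => // i IH; rewrite mkseqS IH.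
Qed.

Section Play.
Variables (G : graph) (m : nat) (p : 'I_m -> 'I_m -> G).
Variable line : bool -> 'I_m -> G -> Prop.
Variables (L psi tau : nat).
Variable q : bool -> 'I_m -> 'I_m -> 'I_m -> seq G.
Implicit Type f : nat -> 'I_m.

(** The robber's play is determined by the sequence [f] of lines that he visits,
    line [f ph] being of kind [odd ph].  Phase [ph] consists of [tau] stages; it
    starts at the corner where lines [ph] and [ph.+1] cross, and follows line
    [ph.+1] to the next corner.  The leg walked in this phase is cut into pieces
    of length [psi], one for each stage; when the leg is exhausted the pieces
    are empty and the robber waits. *)
Definition corner f ph := crossing p (odd ph) (f ph) (f ph.+1).
Definition leg f ph := q (~~ odd ph) (f ph.+1) (f ph) (f ph.+2).
Definition play f i : seq G :=
  take psi (drop (i %% tau * psi) (leg f (i %/ tau))).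

(** Phase [ph] ends on line [ph.+2], hence uses nothing of [f] beyond that. *)
Lemma play_ext f g i :
  {in gtn (i %/ tau).+3, f =1 g} -> play f i = play g i.
Proof. by move=> fg; rewrite /play /leg !fg// !inE; lia. Qed.

Hypothesis qP : forall b i j j',
  route (line b i) L (crossing p b i j) (crossing p b i j') (q b i j j').
Hypotheses (tau_gt0 : 0 < tau) (Ltau : L <= tau * psi).

Lemma legP f ph :
  route (line (odd ph.+1) (f ph.+1)) L (corner f ph) (corner f ph.+1) (leg f ph).
Proof. by rewrite /corner -crossingC; apply: qP. Qed.

Lemma play_pos f ph r : r <= tau ->
  robber_pos (corner f 0) (play f) (ph * tau + r) =
  last (corner f ph) (take (r * psi) (leg f ph)).
Proof.
elim: ph r => [|ph IHph]; elim=> [|r IHr] r_tau.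
- by rewrite /= take0.
- rewrite addnS /= IHr 1?ltnW// /play divnMDl// modnMDl divn_small// modn_small//.
  by rewrite addn0 mulSn addnC takeD last_cat.
- rewrite addn0 mulSn addnC IHph// take0 /=.
  by have [_ <- sz _] := legP f ph; rewrite take_oversize// (leq_trans sz).
- rewrite addnS /= IHr 1?ltnW// /play divnMDl// modnMDl divn_small// modn_small//.
  by rewrite addn0 mulSn [psi + _]addnC takeD last_cat.
Qed.

Lemma play_posE f i :
  robber_pos (corner f 0) (play f) i =
  last (corner f (i %/ tau)) (take (i %% tau * psi) (leg f (i %/ tau))).
Proof. by rewrite {1}(divn_eq i tau) play_pos// ltnW// ltn_pmod. Qed.

Lemma play_legal f : robber_legal psi (corner f 0) (play f).
Proof.
move=> i; split; last by rewrite /play size_take_min geq_minl.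
rewrite play_posE /play; have [qpath _ _ _] := legP f (i %/ tau).
apply: take_path; move: qpath.
by rewrite -{1}(cat_take_drop (i %% tau * psi) (leg _ _)) cat_path => /andP[].
Qed.

Lemma play_line f i x :
  x \in robber_pos (corner f 0) (play f) i :: play f i ->
  line (odd (i %/ tau).+1) (f (i %/ tau).+1) x.
Proof.
have [_ _ _ qline] := legP f (i %/ tau); rewrite inE => xi; apply: qline.
case/orP: xi => [/eqP->|/mem_take/mem_drop xq]; last by rewrite inE xq orbT.
rewrite play_posE; have := mem_last (corner f (i %/ tau))
  (take (i %% tau * psi) (leg f (i %/ tau))).
by rewrite !inE => /orP[->//|/mem_take ->]; rewrite orbT.
Qed.

End Play.

(** Line [ph] is selected at the beginning of phase [ph - 2], out of the lines at
    distance more than [rho + 2 * tau * sigma] from all cops, and it is followed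
    in phase [ph - 1].  The two phases from its selection to the end of its use
    allow a cop to approach it by at most [2 * tau * sigma].  The truncated
    subtraction makes the lines 0 and 1, that determine the start, depend on the
    starting positions of the cops only. *)
Lemma grid_robber_wins (G : graph) k m L D p line (v : G) sigma psi rho R tau :
  @grid G m L D p line -> k < m -> 0 < tau -> L <= tau * psi ->
  2 * (rho + 2 * tau * sigma) <= D -> (forall i j, gdist v (p i j) <= R) ->
  ~ cops_win k v sigma psi rho R.
Proof.
move=> gr km tau0 Ltau dD vR [s win].
pose x0 : 'I_m := Ordinal (leq_ltn_trans (leq0n k) km).
pose q b i j j' := projT1 (cid (grid_route gr b i j j')).
have qP b i j j' :
    route (line b i) L (crossing p b i j) (crossing p b i j') (q b i j j').
  by rewrite /q; case: cid.
pose start f := corner p f 0; pose mv := play psi tau q.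
pose cops f ph := cop_pos s (start f) (mv f) ((ph - 2) * tau).
have [f fP] : exists f : nat -> 'I_m, forall ph,
    forall j y, line (odd ph) (f ph) y ->
    rho + 2 * tau * sigma < gdist (cops f ph j) y.
  pose P (l : seq 'I_m) i := forall j y, line (odd (size l)) i y ->
    rho + 2 * tau * sigma < gdist (cops (nth x0 l) (size l) j) y.
  have [f fP] : exists f : nat -> 'I_m, forall ph, P (mkseq f ph) (f ph).
    by apply: history_choice => l; apply: (far_line _ _ gr).
  exists f => ph j y; have := fP ph j y; rewrite size_mkseq.
  set g := nth x0 _; have fg i : i < ph -> f i = g i.
    by move=> iph; rewrite /g nth_mkseq.
  suff -> : cops g ph = cops f ph by [].
  (* The moves before phase [ph - 2] involve lines before line [ph] only. *)
  apply/esym/cop_pos_ext => [pos|i iph].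
    by rewrite /start /corner !fg//; nia.
  apply: play_ext => a; rewrite inE => aph; apply: fg.
  have := iph; rewrite -ltn_divLR //; lia.
have /win[legal] : robber_legal psi (start f) (mv f).
  exact: play_legal qP tau0 Ltau f.
have safe ph i j y : line (odd ph) (f ph) y -> ph.-2 * tau <= i <= ph * tau ->
    rho < gdist (cop_pos s (start f) (mv f) i j) y.
  move=> liney iph; have := fP _ j _ liney; rewrite /cops subn2.
  set i0 := _ * tau in iph *.
  have /andP[i0i iE] : i0 <= i <= i0 + 2 * tau by rewrite /i0; nia.
  have := cop_pos_dist j i0 (i - i0) legal; rewrite subnKC//.
  have := gdist_triangle (cop_pos s (start f) (mv f) i0 j)
    (cop_pos s (start f) (mv f) i j) y.
  have : (i - i0) * sigma <= 2 * tau * sigma.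
    by rewrite leq_mul2r leq_subLR iE orbT.
  lia.
have on_line := play_line qP tau0 Ltau.
case=> [[[j]|[i [j [x [xi]]]]]|[N /(_ (N * tau))]].
- rewrite leqNgt => /negP; apply; apply: (safe 1 0) => //.
  have := @on_line f 0 (start f); rewrite div0n; apply.
  by rewrite inE eqxx.
- rewrite leqNgt => /negP; apply; apply: safe (on_line _ _ _ xi) _.
  have := ltn_pmod i tau0; have := divn_eq i tau; nia.
- (* Corners are crossings of the grid, hence in the ball around [v]. *)
  have xN : corner p f N \in
      robber_pos (start f) (mv f) (N * tau) :: mv f (N * tau).
    have /= := play_pos qP tau0 Ltau f N (leq0n tau).
    by rewrite addn0 take0 inE => ->; rewrite eqxx.
  move=> /(_ (leq_pmulr N tau0) _ xN); rewrite ltnNge /corner /crossing.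
  by case: ifP => _; rewrite vR.
Qed.

(** The length of the routes is proportional to the distance of the lines, with
    a ratio that does not depend on the scale [N]. *)
Definition has_grids (G : graph) (m : nat) : Prop :=
  exists C, forall N, 0 < N -> exists p line, @grid G m (C * N) N p line.

Lemma has_grids_sCop (G : graph) :
  G -> (forall m, has_grids G m) -> sCop G = +oo%E.
Proof.
move=> v grids; rewrite /sCop; case: pselect => // ex_k; exfalso.
case: ex_k => k /andP[_ /asboolP /(_ v)[sigma [sigma0]]].
have [C gridsC] := grids k.+1.
move=> /(_ (16 * C.+1 * sigma)) [|rho [rho0]].
  by rewrite !muln_gt0 sigma0.
pose N := 4 * rho + 8 * sigma.
have [|p [line gr]] := gridsC N; first by rewrite /N; lia.
pose R := (\max_(i < k.+1) \max_(j < k.+1) gdist v (p i j)).+1.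
move=> /(_ R isT).
(* With phases of [N / (8 sigma)] stages, two phases move a cop by at most
   [N / 4], and [rho <= N / 4]: twice the sum is at most [N]. *)
apply: (@grid_robber_wins _ _ _ _ _ _ _ _ _ _ _ _
  (N %/ (8 * sigma)) gr) => //.
- by rewrite divn_gt0; lia.
- have t1 : 1 * (8 * sigma) <= N %/ (8 * sigma) * (8 * sigma).
    by rewrite leq_mul2r divn_gt0; lia.
  (* Rounding down at most halves a quotient that is at least 1. *)
  have Nt : N <= N %/ (8 * sigma) * (16 * sigma).
    have := divn_eq N (8 * sigma); have := ltn_pmod N (d := 8 * sigma); lia.
  have := leq_mul (leqnSn C) Nt; lia.
- by have := divn_eq N (8 * sigma); lia.
- move=> i j; apply: leqW; apply: leq_trans (leq_bigmax i).
  exact: (leq_bigmax (F := fun j => gdist v (p i j)) j).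
Qed.

(** The image of a line has gaps, which are filled by short routes; its
    neighbourhood of radius [K] contains them.  Lines that are [E * N] apart
    remain [N] apart after the map and after this thickening. *)
Lemma has_grids_bilipschitz (G G' : graph) (f : G -> G') K K' m :
  (forall x y, adj x y -> gdist (f x) (f y) <= K) ->
  (forall x y, gdist x y <= K' * gdist (f x) (f y)) ->
  has_grids G m -> has_grids G' m.
Proof.
move=> fK fK' [C gridsC]; pose E := K'.+1 * (2 * K).+1.
exists (K * (C * E)) => N N0.
have [|p [line gr]] := gridsC (E * N); first by rewrite /E; lia.
pose thick b i x := exists2 y, line b i y & gdist (f y) x <= K.
have image P L x y : joined P L x y ->
    joined (fun z => exists2 y, P y & gdist (f y) z <= K) (K * L) (f x) (f y).
  have gdistxx z : gdist (f z) (f z) <= K.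
    by rewrite (leq_trans (gdist_le_size (p := [::]) isT)).
  move=> [q [+ + + +]]; elim: q x L => [|z q IH] x L /=.
    move=> _ <- _ Px; apply: joined_refl; exists x => //.
    by apply: Px; rewrite inE.
  move=> /andP[/fK xz zq] qy; case: L => // L qL qP; rewrite mulnS.
  have [r [? ? ? rP]] := joined_ball xz.
  apply: (@joined_trans _ _ _ _ (f z)).
    exists r; split=> // w wr; exists x; last exact: rP.
    by apply: qP; rewrite inE eqxx.
  by apply: IH => // w wq; apply: qP; rewrite inE wq orbT.
exists (fun i j => f (p i j)), thick; split.
  move=> b i j j'; rewrite -(mulnA K) -(mulnA C).
  by have := image _ _ _ _ (grid_route gr b i j j'); case: b.
move=> b i i' x x' ii' [y iy yx] [y' iy' yx']; rewrite ltnNge; apply/negP => xx'.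
have := grid_separated gr ii' iy iy'; rewrite ltnNge => /negP; apply.
apply: leq_trans (fK' y y') _.
have := gdist_triangle (f y) x (f y').
have := gdist_triangle x x' (f y'); rewrite (gdist_sym x' (f y')) => t1 t2.
have ff : gdist (f y) (f y') <= (2 * K).+1 * N by nia.
by rewrite /E -mulnA leq_mul.
Qed.

(** * Cayley graphs *)

Section CayleyMetric.
Variables (gT : groupType).
Implicit Types x y z : gT.

Lemma cay_gdist_translate (S : seq gT) (genS : generates S) z x y :
  gdist (z * x : Cay genS)%g (z * y : Cay genS)%g <= gdist (x : Cay genS) y.
Proof.
have [p [xp <- <-]] := gdist_path (x : Cay genS) y.
have -> : (z * last x p)%g = last (z * x)%g (map ( *%g z)%g p) by rewrite last_map.
rewrite -(size_map ( *%g z)%g) (@gdist_le_size (Cay genS))//.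
rewrite path_map; apply: sub_path xp => a b /=.
rewrite /cay_adj (inj_eq (mulgI z)) !invgM -!mulgA.
by rewrite !(mulgA z^-1%g) mulVg !mul1g.
Qed.

Lemma cay_adj_bounded (S S' : seq gT) (genS : generates S)
    (genS' : generates S') :
  exists K, forall x y, cay_adj S x y -> gdist (x : Cay genS') y <= K.
Proof.
exists (\max_(s <- S) gdist (1%g : Cay genS') s).
have one_way x y : (x^-1 * y)%g \in S ->
    gdist (x : Cay genS') y <= \max_(s <- S) gdist (1%g : Cay genS') s.
  move=> xyS; apply: leq_trans (leq_bigmax_seq _ xyS isT).
  have := cay_gdist_translate genS' x 1%g (x^-1 * y)%g.
  by rewrite mulg1 mulVKg.
by move=> x y /andP[_ /orP[]/one_way//]; rewrite gdist_sym.
Qed.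

(** Changing the generators changes the metric by bounded factors only. *)
Lemma has_grids_cay (S S' : seq gT) (genS : generates S)
    (genS' : generates S') m :
  has_grids (Cay genS) m -> has_grids (Cay genS') m.
Proof.
have [K KP] := cay_adj_bounded genS genS'.
have [K' KP'] := cay_adj_bounded genS' genS.
apply: (@has_grids_bilipschitz (Cay genS) (Cay genS') id K K') => [//|x y].
have [q [xq <- <-]] := gdist_path (x : Cay genS') y.
elim: q x xq => [|z q IH] x /=.
  by rewrite muln0 (@gdist_le_size (Cay genS) x [::]).
move=> /andP[/KP' xz /IH zq]; rewrite mulnS.
by apply: leq_trans (gdist_triangle _ (z : Cay genS) _) _; apply: leq_add.
Qed.

Lemma joined_expg (S : seq gT) (genS : generates S) g (P : gT -> Prop) d x :
  g \in S -> (forall e, e <= d -> P (x * g ^+ e)%g) ->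
  @joined (Cay genS) P d x (x * g ^+ d)%g.
Proof.
move=> gS; elim: d => [|d IH] Pxg.
  rewrite expg0 mulg1; apply: (@joined_refl (Cay genS)).
  by have := Pxg 0 isT; rewrite mulg1.
rewrite -addn1; apply: (@joined_trans (Cay genS) _ _ _ (x * g ^+ d)%g).
  by apply: IH => e ed; apply: Pxg; apply: leqW.
rewrite addn1 expgSr mulgA.
(* A generator may be trivial, and then gives no edge. *)
have [->|ne] := eqVneq (x * g ^+ d * g)%g (x * g ^+ d)%g.
  by apply: (@joined_refl (Cay genS)); apply: Pxg.
exists [:: (x * g ^+ d * g)%g]; split=> //=.
  by rewrite andbT /cay_adj eq_sym ne mulKg gS.
move=> z; rewrite !inE => /orP[]/eqP->; first exact: Pxg.
by rewrite -mulgA -expgSr; apply: Pxg.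
Qed.

End CayleyMetric.

(** * The affine action of BS(1,n) *)

Section Affine.
Import Order.TTheory GRing.Theory Num.Theory.
Local Open Scope ring_scope.
Variable n : nat.
Hypothesis n_gt0 : (0 < n)%N.

Local Notation nQ := (n%:R : rat).

Let nQ_neq0 : nQ != 0. Proof. by rewrite pnatr_eq0 -lt0n. Qed.
Let nQ_gt0 : 0 < nQ. Proof. by rewrite ltr0n. Qed.

(** The pair [(b, e)] stands for the affine map that sends [x] to [n^e x + b], and
    the product for composition.  For [n = 1] the exponent cannot be read off
    from the map, so it is kept as a separate component. *)
Definition aff_mul (f g : rat * int) : rat * int :=
  (f.1 + nQ ^ f.2 * g.1, f.2 + g.2).

Definition letter_aff (l : bs_gen * bool) : rat * int :=
  let s := if l.2 then - 1 else 1 in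
  if l.1 is gen_a then (s%:~R, 0) else (0, s).

Definition word_aff (w : word bs_gen) : rat * int :=
  foldr (fun l => aff_mul (letter_aff l)) (0, 0) w.

Lemma aff_mulA : associative aff_mul.
Proof.
move=> [b1 e1] [b2 e2] [b3 e3]; rewrite /aff_mul /= expfzDr//; congr pair; ring.
Qed.

Lemma aff_mul1 f : aff_mul (0, 0) f = f.
Proof. by case: f => b e; rewrite /aff_mul /= add0r expr0z mul1r add0r. Qed.

Lemma word_aff_cat u w : word_aff (u ++ w) = aff_mul (word_aff u) (word_aff w).
Proof.
elim: u => [|l u IH] /=; first by rewrite aff_mul1.
by rewrite /word_aff /= -/(word_aff _) IH aff_mulA.
Qed.

Lemma word_aff_nseq d x : word_aff (nseq d (x, false)) =
  if x is gen_a then (d%:R, 0) else (0, d%:Z).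
Proof.
elim: d => [|d IH]; first by case: x.
rewrite /= -/(word_aff _) IH; case: x {IH}; rewrite /aff_mul /letter_aff /=.
  by rewrite expr0z mul1r -natr1 addrC addr0.
by rewrite mulr0 add0r intS.
Qed.

Definition bs_aff (x : BS1 n) : rat * int := word_aff (repr x).

Lemma word_aff_pres_eq (v w : word bs_gen) :
  (pres_class _ v : BS1 n) = pres_class _ w -> word_aff v = word_aff w.
Proof.
move/pres_classP; elim=> {v w} //.
- by move=> w1 w2 w3 _ -> _ ->.
- move=> u v x b; rewrite !word_aff_cat; congr aff_mul.
  rewrite -[RHS]aff_mul1; congr aff_mul; rewrite /word_aff /aff_mul /letter_aff.
  by case: x; case: b; rewrite /= ?expr0z ?expr1z ?mulr0 ?mul1r ?addr0.
- move=> u v l r; rewrite inE => /eqP[-> ->]; rewrite !word_aff_cat.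
  congr (aff_mul _ (aff_mul _ _)); rewrite word_aff_nseq /word_aff /aff_mul /=.
  by rewrite expr0z expr1z !mulr0 !addr0 !add0r mulr1.
Qed.

Lemma bs_affE w : bs_aff (pres_class _ w) = word_aff w.
Proof. exact/word_aff_pres_eq/pres_class_repr. Qed.

Lemma bs_affM x y : bs_aff (x * y)%g = aff_mul (bs_aff x) (bs_aff y).
Proof.
by rewrite -(pres_class_repr x) -(pres_class_repr y) -pres_class_cat !bs_affE
  word_aff_cat.
Qed.

Lemma bs_aff_aX d : bs_aff (bs_a n ^+ d)%g = (d%:R, 0).
Proof. by rewrite /bs_a -pres_class_nseq bs_affE word_aff_nseq. Qed.

Lemma bs_aff_tX d : bs_aff (bs_t n ^+ d)%g = (0, d%:Z).
Proof. by rewrite /bs_t -pres_class_nseq bs_affE word_aff_nseq. Qed.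

(** Necessary conditions for being a product of [s] letters: along a word of
    length [s], each letter [a] changes the first component by [n^e] with
    [-s < e < s].  Both the resulting bound on its size, and the one on its
    denominator, are used: they separate the rows and the columns. *)
Definition aff_ball (s : nat) (f : rat * int) : Prop :=
  [/\ `|f.2| <= s%:Z, `|f.1| <= \sum_(i < s) nQ ^+ i
    & exists z : int, nQ ^+ s * f.1 = z%:~R].

Lemma aff_ball_letter s l f :
  aff_ball s f -> aff_ball s.+1 (aff_mul (letter_aff l) f).
Proof.
case: f l => [b e] [x c] [/= es bs [z bz]].
have nb : nQ * `|b| <= \sum_(i < s.+1) nQ ^+ i.
  rewrite big_ord_recl mulrC expr0 ler_wpDl//.
  under eq_bigr => i _ do rewrite exprS.
  by rewrite -mulr_sumr mulrC ler_pM2l.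
have b_le : `|b| + 1 <= \sum_(i < s.+1) nQ ^+ i.
  rewrite big_ord_recl expr0 addrC lerD2l (le_trans bs)// ler_sum// => i _.
  by rewrite exprS ler_peMl ?exprn_ge0 ?ler1n ?ler0n.
case: x; rewrite /aff_mul /letter_aff /=.
  split; rewrite ?add0r ?expr0z ?mul1r /=.
  - by rewrite (le_trans es)// lez_nat.
  - apply: le_trans b_le; rewrite addrC (le_trans (ler_normD _ _))// lerD2l.
    by case: c.
  - exists ((n ^ s.+1)%:Z * (if c then -1 else 1) + n%:Z * z).
    by rewrite intrD !intrM -bz -!pmulrn natrX exprS; ring.
rewrite add0r; split=> /=; first by case: c; lia.
  apply: le_trans nb; rewrite normrM ler_wpM2r//.
  case: c; rewrite ?exprN1 ?expr1z ger0_norm ?invr_ge0 ?ler0n//.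
  by apply: le_trans (_ : 1 <= _); rewrite ?ler1n// invf_le1 ?ler1n.
case: c; rewrite ?exprN1 ?expr1z exprS.
  by exists z; rewrite mulrACA -bz; field.
exists (n%:Z * (n%:Z * z)); rewrite !intrM -bz -pmulrn; ring.
Qed.

Lemma word_aff1 l : word_aff [:: l] = letter_aff l.
Proof. by rewrite /word_aff /= /aff_mul /= mulr0 !addr0 -surjective_pairing. Qed.

Lemma aff_ball0 : aff_ball 0 (0, 0).
Proof. by split; rewrite /= ?normr0 ?big_ord0//; exists 0; rewrite mulr0. Qed.

Local Notation Gamma := (Cay (@BS1_generates n)).

Lemma adj_letter (x y : Gamma) :
  adj x y -> exists l, bs_aff (x^-1 * y)%g = letter_aff l.
Proof.
have gen (g : BS1 n) : g \in [:: bs_a n; bs_t n] -> exists k, g = pres_gen _ k.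
  by rewrite !inE => /orP[]/eqP->; [exists gen_a|exists gen_t].
move=> /andP[_ /orP[]/gen[k kE]].
  by exists (k, false); rewrite kE bs_affE word_aff1.
exists (k, true); rewrite -[(x^-1 * y)%g]invgK invgM invgK kE -pres_genV.
by rewrite bs_affE word_aff1.
Qed.

Lemma gdist_aff (x y : Gamma) :
  exists2 f, aff_ball (gdist x y) f & bs_aff y = aff_mul (bs_aff x) f.
Proof.
exists (bs_aff (x^-1 * y)%g); last by rewrite -bs_affM mulVKg.
have [q [xq <- <-]] := gdist_path x y.
elim: q x xq => [|z q IH] x /=.
  by rewrite mulVg -(expg0 (bs_a n)) bs_aff_aX => _; exact: aff_ball0.
move=> /andP[/adj_letter[l xz] /IH zq].
have -> : (x^-1 * last z q = x^-1 * z * (z^-1 * last z q))%g.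
  by rewrite -mulgA mulVKg.
by rewrite bs_affM xz; apply: aff_ball_letter.
Qed.

(** Starting from height at most [H], a path of length at most [H] does not climb
    above height [2 * H], so moves the real part by less than [n^(2H)]. *)
Lemma gdist_low (x y : Gamma) H : (1 < n)%N -> (bs_aff x).2 <= H%:Z ->
  (gdist x y <= H)%N ->
  `|(bs_aff x).1 - (bs_aff y).1| <= nQ ^+ H * (nQ ^+ H - 1).
Proof.
move=> n1 xH; have [[b e] [_ /= bd _] ->] := gdist_aff x y => dH /=.
have nQ1 : 1 <= nQ by rewrite ler1n.
rewrite opprD addNKr normrN normrM ler_pM ?normr_ge0//.
  rewrite ger0_norm ?exprz_ge0 ?ler0n// -[nQ ^+ H]/(nQ ^ H%:Z).
  by rewrite ler_weXz2l.
apply: le_trans bd _; apply: (@le_trans _ _ (nQ ^+ gdist x y - 1)); last first.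
  by rewrite lerD2r ler_weXn2l.
rewrite subrX1 ler_peMl ?sumr_ge0// => [i _|]; first by rewrite exprn_ge0 ?ler0n.
by rewrite lerBrDr -[1 + 1]/(2%:R) ler_nat.
Qed.

(** A path of length at most [H - q] from height at least [H] stays above height
    [q], where all moves of the real part are multiples of [n^q]. *)
Lemma gdist_high (x y : Gamma) H q : H%:Z <= (bs_aff x).2 ->
  (gdist x y + q <= H)%N ->
  exists z : int, (bs_aff y).1 - (bs_aff x).1 = z%:~R * nQ ^+ q.
Proof.
move=> xH; have [[b e] [_ _ [z /= bz]] ->] := gdist_aff x y => dH /=.
set d := gdist x y in bz dH.
have [r hE] : exists r : nat, (bs_aff x).2 = r%:Z + q%:Z + d%:Z.
  by exists (absz ((bs_aff x).2 - q%:Z - d%:Z)%R); lia.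
exists (n%:Z ^+ r * z); rewrite addrC addKr hE !expfzDr// -!exprnP.
have nr : ((n%:Z ^+ r)%:~R : rat) = nQ ^+ r by rewrite rmorphXn.
by rewrite intrM -bz nr -!mulrA; congr (_ * _); rewrite mulrC -mulrA.
Qed.

(** * Grids in BS(1,n) *)

Lemma bs_aff_at c h : bs_aff (bs_a n ^+ c * bs_t n ^+ h)%g = (c%:R, h%:Z).
Proof. by rewrite bs_affM bs_aff_aX bs_aff_tX /aff_mul /= mulr0 addr0 add0r. Qed.

Lemma bs_tX_aX h e :
  (bs_t n ^+ h * bs_a n ^+ e = bs_a n ^+ (e * n ^ h) * bs_t n ^+ h)%g.
Proof.
have ta k : (bs_t n * bs_a n ^+ k = bs_a n ^+ (k * n) * bs_t n)%g.
  elim: k => [|k IH]; first by rewrite !expg0 mulg1 mul1g.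
  rewrite expgSr mulgA IH -mulgA mulSn addnC expgnDr -mulgA.
  by congr (_ * _)%g; rewrite -BS1_relation mulgVK.
elim: h => [|h IH]; first by rewrite !expg0 mulg1 mul1g muln1.
by rewrite expgS -mulgA IH mulgA ta -mulgA -expgS expnSr mulnA.
Qed.

(** At height [h] a step along [a] adds [n^h] to the real part, so [d] steps
    suffice for an exponentially long translation. *)
Lemma joined_a (P : BS1 n -> Prop) c h d :
  (forall e, (e <= d)%N -> P (bs_a n ^+ (c + e * n ^ h) * bs_t n ^+ h)%g) ->
  @joined Gamma P d (bs_a n ^+ c * bs_t n ^+ h)%g
    (bs_a n ^+ (c + d * n ^ h) * bs_t n ^+ h)%g.
Proof.
move=> Pe; have shift e : (bs_a n ^+ (c + e * n ^ h) * bs_t n ^+ h =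
    bs_a n ^+ c * bs_t n ^+ h * bs_a n ^+ e)%g.
  by rewrite -[RHS]mulgA bs_tX_aX expgnDr -mulgA.
rewrite shift; apply: joined_expg => [|e ed]; first by rewrite mem_head.
by rewrite -shift; apply: Pe.
Qed.

Lemma joined_t (P : BS1 n -> Prop) c h d :
  (forall e, (e <= d)%N -> P (bs_a n ^+ c * bs_t n ^+ (h + e))%g) ->
  @joined Gamma P d (bs_a n ^+ c * bs_t n ^+ h)%g
    (bs_a n ^+ c * bs_t n ^+ (h + d))%g.
Proof.
move=> Pe; rewrite expgnDr mulgA.
apply: joined_expg => [|e ed]; first by rewrite !inE eqxx orbT.
by rewrite -mulgA -expgnDr; apply: Pe.
Qed.

Lemma has_grids_BS11 m : n = 1%N -> has_grids Gamma m.
Proof.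
move=> n1; exists (2 * m)%N => N N0.
pose D := N.+1; pose p (i j : 'I_m) : Gamma :=
  (bs_a n ^+ (j * D) * bs_t n ^+ (i * D))%g.
pose line (b : bool) (i : 'I_m) (x : Gamma) : Prop :=
  if b then (bs_aff x).1 = (i * D)%:R else (bs_aff x).2 = (i * D)%:Z.
have far (i i' : 'I_m) : i != i' -> (N%:Z < `|(i * D)%:Z - (i' * D)%:Z|).
  by rewrite -val_eqE /= /D => ii'; nia.
exists p, line; split=> [b i j j'|b i i' x y ii' xi yi'].
  wlog jj' : j j' / (j <= j')%N.
    move=> H; have [/H//|/ltnW/H] := leqP j j'; exact: joined_sym.
  have DE : (j' * D = j * D + (j' - j) * D)%N by rewrite -mulnDl subnKC.
  have dL : ((j' - j) * D <= 2 * m * N)%N.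
    have := ltn_ord j'; rewrite /D; nia.
  apply: joined_leq dL _; rewrite /crossing /p; case: b; rewrite DE.
    by apply: joined_t => e _; rewrite /line bs_aff_at.
  have /(_ (line false i)) := @joined_a _ (j * D) (i * D) ((j' - j) * D).
  have -> : (n ^ (i * D) = 1)%N by rewrite n1 exp1n.
  by rewrite muln1; apply=> e _; rewrite /line bs_aff_at.
have [[c e] [/= ed cd _] yE] := gdist_aff x y.
have := far i i' ii'; move: xi yi'; rewrite /line yE /=; case: b => /=; last by lia.
have nQ1 : nQ = 1 by rewrite n1.
have sum1 d : \sum_(k < d) nQ ^+ k = d%:R.
  by under eq_bigr => k _ do rewrite nQ1 expr1n; rewrite sumr_const card_ord.
rewrite nQ1 exp1rz mul1r => xi yi' far'; rewrite sum1 in cd.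
rewrite -ltz_nat (lt_le_trans far')// -(ler_int rat) intr_norm rmorphB /=.
by rewrite -!pmulrn -yi' xi opprD addNKr normrN.
Qed.

(** With [H = 2 * m + N], row [i] lies below height [H] with real part within [m]
    of [i n^(2H)], and column [j] above height [H] with real part congruent to
    [j] modulo [n^m]; these conditions are weaker than being on the stars of the
    complete bipartite graph, but suffice for the distances.  The summand
    [2 * m] of [H] makes [n^H] larger than [2 * m], and keeps a path of length
    [N] from height [H] above height [m], where [n^m > m] distinguishes the
    residues. *)
Lemma has_grids_BS1 m : (1 < n)%N -> has_grids Gamma m.
Proof.
move=> n1; exists (5 * m + 2)%N => N N0.
pose H := (2 * m + N)%N; pose B := (n ^ (H + H))%N.
pose p (i j : 'I_m) : Gamma := (bs_a n ^+ (i * B + j) * bs_t n ^+ H)%g.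
pose line (b : bool) (i : 'I_m) (x : Gamma) : Prop :=
  if b then H%:Z <= (bs_aff x).2 /\
    exists z : int, (bs_aff x).1 = i%:R + z%:~R * nQ ^+ m
  else (bs_aff x).2 <= H%:Z /\ `|(bs_aff x).1 - (i * B)%:R| <= m%:R.
have L : (H + (m + H) = 5 * m + 2 * N)%N by rewrite /H; lia.
have {}L : (H + (m + H) <= (5 * m + 2) * N)%N by rewrite L; nia.
exists p, line; split=> [b i j j'|].
  wlog jj' : j j' / (j <= j')%N.
    move=> wl; have [/wl//|/ltnW/wl] := leqP j j'; exact: joined_sym.
  have j'm := ltn_ord j'.
  have j'E : (j' = j + (j' - j) :> nat)%N by rewrite subnKC.
  apply: joined_leq L _; rewrite /crossing /p; case: b => /=.
    (* Column [i], from crossing [j] to crossing [j']: up, across, down. *)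
    have on_line c h : (H <= h)%N ->
        line true i (bs_a n ^+ (c * B + i) * bs_t n ^+ h)%g.
      move=> Hh; rewrite /line bs_aff_at /=; split; first by rewrite lez_nat.
      exists (c * n ^ (H + H - m))%N; rewrite natrD addrC; congr (_ + _).
      rewrite -pmulrn -natrX -natrM; congr (_%:R); rewrite -mulnA -expnD subnK//.
      rewrite /H; lia.
    apply: (@joined_trans Gamma _ _ _
      (bs_a n ^+ (j * B + i) * bs_t n ^+ (H + H))%g).
      by apply: joined_t => e _; apply: on_line; lia.
    apply: (@joined_trans Gamma _ _ _
      (bs_a n ^+ (j' * B + i) * bs_t n ^+ (H + H))%g).
      rewrite j'E mulnDl addnAC; apply: joined_leq (joined_a _); first by lia.
      by move=> e _; rewrite addnAC -mulnDl; apply: on_line; lia.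
    by apply: joined_sym; apply: joined_t => e _; apply: on_line; lia.
  (* Row [i], from crossing [j] to crossing [j']: down, across, up. *)
  have on_line c h : (h <= H)%N -> (c <= m)%N ->
      line false i (bs_a n ^+ (i * B + c) * bs_t n ^+ h)%g.
    move=> hH cm; rewrite /line bs_aff_at /=; split; first by rewrite lez_nat.
    by rewrite natrD addrAC subrr add0r normr_nat ler_nat.
  have down (c : 'I_m) : @joined Gamma (line false i) H
      (bs_a n ^+ (i * B + c) * bs_t n ^+ 0)%g
      (bs_a n ^+ (i * B + c) * bs_t n ^+ H)%g.
    by apply: joined_t => e eH; apply: on_line => //; rewrite ltnW.
  apply: joined_trans (joined_sym (down j)) _; apply: joined_trans (down j').
  (* At height 0 the translation length [n ^ 0] has to be made visible. *)
  rewrite {1}j'E addnA -[X in (_ + _ + X)%N]muln1.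
  rewrite -[1%N in X in (_ + _ + X)%N](expn0 n).
  apply: joined_leq (joined_a _); first by lia.
  by move=> e ed; rewrite muln1 -addnA; apply: on_line => //; lia.
have nm : (m < n ^ m)%N by rewrite ltn_expl.
have nH : (2 * m < n ^ H)%N by rewrite (leq_trans _ (ltn_expl H n1))// /H; lia.
move=> [] i i' x y ii' [hx xi] [hy yi']; rewrite ltnNge; apply/negP => dN.
  have [|w xy] := gdist_high (q := m) hx _ (y := y); first by rewrite /H; lia.
  have [z xz] := xi; have [z' yz'] := yi'.
  have diff : i'%:Z - i%:Z = (w + z - z') * (n ^ m)%N%:Z.
    apply: (@intr_inj rat).
    rewrite rmorphB /= intrM rmorphB rmorphD /= -!pmulrn natrX.
    by move: xy; rewrite xz yz' => xy; rewrite mulrBl mulrDl -xy; ring.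
  (* Residues below [m] that differ by a multiple of [n ^ m > m] are equal. *)
  have := ltn_ord i; have := ltn_ord i'; move: ii' nm diff; rewrite -val_eqE /=.
  set K := (n ^ m)%N; move: (w + z - z') => u ii' nm diff im im'.
  have [u0|[u0|u0]] : u = 0 \/ 1 <= u \/ u <= - 1 by lia.
  - by move: diff; rewrite u0; lia.
  - by nia.
  - by nia.
have dH : (gdist x y <= H)%N by rewrite /H; lia.
have := gdist_low n1 hx dH.
have BE : B%:R = nQ ^+ H * nQ ^+ H.
  by rewrite /B natrX exprD.
have {}nH : (2 * m)%:R < nQ ^+ H by rewrite -natrX ltr_nat.
move: xi yi'; rewrite !natrM BE !ler_norml.
move=> /andP[x1 x2] /andP[y1 y2] /andP[d1 d2].
have X0 : 0 <= nQ ^+ H * nQ ^+ H by rewrite mulr_ge0 ?exprn_ge0 ?ler0n.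
move: ii'; rewrite -val_eqE neq_ltn => /orP[lt|lt].
- have := ler_wpM2r X0 (_ : i.+1%:R <= i'%:R :> rat).
  rewrite ler_nat -natr1 => /(_ lt).
  by rewrite natrM in nH; lra.
- have := ler_wpM2r X0 (_ : i'.+1%:R <= i%:R :> rat).
  rewrite ler_nat -natr1 => /(_ lt).
  by rewrite natrM in nH; lra.
Qed.

End Affine.

Theorem theorem1p6 (n : nat) (n_ge1 : 1 <= n)
    (S : seq (BS1 n)) (genS : generates S) :
  sCop (Cay genS) = (+oo)%E.
Proof.
apply: has_grids_sCop => [|m]; first exact: (1%g : BS1 n).
apply: (has_grids_cay (genS := @BS1_generates n)).
move: (n_ge1); rewrite leq_eqVlt => /predU1P[n1|n_gt1].
  exact: (has_grids_BS11 n_ge1 m (esym n1)).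
exact: (has_grids_BS1 n_ge1 m n_gt1).
Qed.
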